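(* For all ordered graphs $\mathcal G$ and $\mathcal H$, $$R(\mathcal G)+R(\mathcal H)\le R(\mathcal G+\mathcal H)\le R(\mathcal G)+R(\mathcal H)+R(\mathcal H+\mathcal G).$$
   Context: An ordered graph is a finite simple graph (with nonempty vertex set) with a linear ordering of its vertices. A copy of $\mathcal H$ in $\mathcal G$ is an order-preserving injection from the vertices of $\mathcal H$ to those of $\mathcal G$ that maps edges to edges. $R(\mathcal G)$ is the minimum $N$ such that every 2-coloring of the edges of the complete ordered graph on $N$ vertices contains a monochromatic copy of $\mathcal G$. $\mathcal G+\mathcal H$ is the ordered graph on $v(\mathcal G)+v(\mathcal H)$ vertices in which the first $v(\mathcal G)$ vertices form a copy of $\mathcal G$, the remaining $v(\mathcal H)$ vertices form a copy of $\mathcal H$, and there are no other edges; $v(\cdot)$ denotes the number of vertices. *)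

(* Defs.v *)
From HB Require Import structures.
From mathcomp Require Import all_boot all_order.
Set Implicit Arguments.
Unset Strict Implicit.
Unset Printing Implicit Defensive.
Import Order.TTheory.
Local Open Scope order_scope.

(* The empty graph is allowed here, so that the complete graph on N vertices is
   available for every N; nonemptiness of the vertex set is a separate
   hypothesis. *)
Record ograph := OGraph {
  ograph_disp : Order.disp_t;
  vertex :> finOrderType ograph_disp;
  adj : rel vertex;
  adj_sym : symmetric adj;
  adj_irr : irreflexive adj
}.
Arguments adj {o}.

Definition is_copy (H G : ograph) (f : H -> G) : bool :=
  [&& injectiveb f,
      [forall x : H, forall y : H, (x <= y) ==> (f x <= f y)]
    & [forall x : H, forall y : H, adj x y ==> adj (f x) (f y)]].

Section Complete.
Variable N : nat.

Definition complete_adj : rel 'I_N := fun i j => i != j.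

Fact complete_adj_sym : symmetric complete_adj.
Proof. by move=> i j; rewrite /complete_adj eq_sym. Qed.

Fact complete_adj_irr : irreflexive complete_adj.
Proof. by move=> i; rewrite /complete_adj eqxx. Qed.

Definition complete : ograph := OGraph complete_adj_sym complete_adj_irr.
End Complete.

(* The color of the edge xy of K is c [set x; y]; the values of c on sets of
   vertices that are not edges are never consulted. *)
Definition coloring (K : ograph) := {ffun {set K} -> bool}.

Definition is_mono_copy (H K : ograph) (c : coloring K) (b : bool)
    (f : H -> K) : bool :=
  is_copy f &&
  [forall x : H, forall y : H, adj x y ==> (c [set f x; f y] == b)].

Definition arrows (G : ograph) (N : nat) : bool :=
  [forall c : coloring (complete N), exists b : bool,
    exists f : {ffun G -> complete N}, is_mono_copy c b f].

Lemma ramsey_seq (a b : nat) : exists N : nat,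
  forall (T : eqType) (g : rel T) (s : seq T), (N <= size s)%N ->
  exists t : seq T, subseq t s /\
    ((size t = a /\ pairwise g t) \/
     (size t = b /\ pairwise (fun x y => ~~ g x y) t)).
Proof.
elim: a b => [|a IHa] b.
  by exists 0 => T g s _; exists [::]; rewrite sub0seq; split=> //; left.
elim: b => [|b [M IHb]].
  by exists 0 => T g s _; exists [::]; rewrite sub0seq; split=> //; right.
have [L IHL] := IHa b.+1; exists (L + M).+1 => T g [//|x s] lt_sz.
have szs : (L + M <= size s)%N by [].
have := count_predC (g x) s; rewrite -!size_filter => szE.
have [leL|ltL] := leqP L (size (filter (g x) s)).
  have [t [st Ht]] := IHL T g _ leL.
  have sts := subseq_trans st (filter_subseq _ _).
  case: Ht => [[szt pt]|Ht].
    exists (x :: t); rewrite /= eqxx szt pt andbT; split=> //; left; split=> //.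
    by apply/allP => y /(mem_subseq st); rewrite mem_filter => /andP[].
  by exists t; split; [exact: subseq_trans sts (subseq_cons _ _)|right].
have leM : (M <= size (filter (predC (g x)) s))%N.
  by rewrite -(leq_add2l L); apply: (leq_trans szs); rewrite -szE leq_add2r ltnW.
have [t [st Ht]] := IHb T g _ leM.
have sts := subseq_trans st (filter_subseq _ _).
case: Ht => [Ht|[szt pt]].
  by exists t; split; [exact: subseq_trans sts (subseq_cons _ _)|left].
exists (x :: t); rewrite /= eqxx szt pt andbT; split=> //; right; split=> //.
by apply/allP => y /(mem_subseq st); rewrite mem_filter => /andP[].
Qed.

Lemma arrows_ex (G : ograph) : exists N, arrows G N.
Proof.
have [M HM] := ramsey_seq #|G| #|G|; exists M.+1.
apply/forallP => /= c.
pose g : rel 'I_M.+1 := fun i j => c [set i; j].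
have [|t [st Ht]] := HM _ g (enum 'I_M.+1); first by rewrite size_enum_ord.
have [b [szt pt]] : exists b, size t = #|G| /\ pairwise (fun i j => g i j == b) t.
  case: Ht => -[szt pt]; [exists true|exists false]; split=> //.
    by apply: sub_pairwise pt => i j ->.
  by apply: sub_pairwise pt => i j /negbTE ->.
pose rk (x : G) := #|[pred z : G | z < x]|.
have rk_lt x : (rk x < #|G|)%N.
  apply: proper_card; apply/properP; split; first exact/subsetP.
  by exists x => //; rewrite inE ltxx.
have rk_mono x y : x < y -> (rk x < rk y)%N.
  move=> xy; apply: proper_card; apply/properP; split.
    by apply/subsetP => z; rewrite !inE => /lt_trans; apply.
  by exists x; rewrite !inE ?ltxx.
pose f := [ffun x : G => nth (ord0 : 'I_M.+1) t (rk x)].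
have f_lt x y : x < y -> (f x < f y)%O.
  move=> xy; rewrite !ffunE.
  have: pairwise ltn (map val t).
    rewrite -(sorted_pairwise ltn_trans).
    apply: subseq_sorted (map_subseq _ st) _; first exact: ltn_trans.
    by rewrite val_enum_ord iota_ltn_sorted.
  move/(pairwiseP 0%N)/(_ (rk x) (rk y)); rewrite !inE !size_map szt.
  move/(_ (rk_lt x) (rk_lt y) (rk_mono _ _ xy)).
  by rewrite !(nth_map ord0) ?szt.
have f_col x y : x < y -> c [set f x; f y] == b.
  move=> xy; rewrite !ffunE.
  move/(pairwiseP ord0)/(_ (rk x) (rk y)): pt; rewrite !inE szt.
  by move/(_ (rk_lt x) (rk_lt y) (rk_mono _ _ xy)).
have f_inj : injective f.
  by move=> x y fxy; case: (ltgtP x y) => // /f_lt; rewrite fxy ltxx.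
apply/existsP; exists b; apply/existsP; exists f.
have adj_neq (x y : G) : adj x y -> x != y.
  by move=> xy; apply: contraL xy => /eqP ->; rewrite adj_irr.
apply/andP; split; [apply/and3P; split|].
- exact/injectiveP.
- apply/forallP => x; apply/forallP => y; apply/implyP.
  by rewrite le_eqVlt => /orP[/eqP->//|/f_lt/ltW].
- apply/forallP => x; apply/forallP => y; apply/implyP => /adj_neq.
  by apply: contraNneq => /f_inj ->.
apply/forallP => x; apply/forallP => y; apply/implyP => /adj_neq.
by rewrite neq_lt => /orP[|] /f_col //; rewrite setUC.
Qed.

Definition ramsey (G : ograph) : nat := ex_minn (arrows_ex G).

(* osum A B is the disjoint union of A and B, with all of A placed below B. *)
Definition osum (A B : Type) : Type := (A + B)%type.

Fact osum_display : Order.disp_t. Proof. exact: Order.Disp tt tt. Qed.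

Section OrderedSum.
Variables (dA dB : Order.disp_t) (A : finOrderType dA) (B : finOrderType dB).

HB.instance Definition _ := Finite.on (osum A B).

Definition osum_le : rel (osum A B) := fun u v =>
  match u, v with
  | inl x, inl y => x <= y
  | inl _, inr _ => true
  | inr _, inl _ => false
  | inr x, inr y => x <= y
  end.

Fact osum_le_refl : reflexive osum_le.
Proof. by case=> x /=. Qed.

Fact osum_le_anti : antisymmetric osum_le.
Proof. by case=> x [] y //= /le_anti ->. Qed.

Fact osum_le_trans : transitive osum_le.
Proof. by case=> y [] x [] z //=; apply: le_trans. Qed.

Fact osum_le_total : total osum_le.
Proof. by case=> x [] y //=; apply: le_total. Qed.

HB.instance Definition _ := Order.Le_isPOrder.Build osum_display (osum A B)
  osum_le_refl osum_le_anti osum_le_trans.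
HB.instance Definition _ := Order.POrder_isTotal.Build osum_display (osum A B)
  osum_le_total.
End OrderedSum.

Section GraphSum.
Variables G H : ograph.

Definition gsum_adj : rel (osum G H) := fun u v =>
  match u, v with
  | inl x, inl y => adj x y
  | inr x, inr y => adj x y
  | _, _ => false
  end.

Fact gsum_adj_sym : symmetric gsum_adj.
Proof. by case=> x [] y //=; apply: adj_sym. Qed.

Fact gsum_adj_irr : irreflexive gsum_adj.
Proof. by case=> x /=; apply: adj_irr. Qed.

Definition gsum : ograph := OGraph gsum_adj_sym gsum_adj_irr.
End GraphSum.

(* Main.v *)
Require Import Defs.
From mathcomp Require Import all_boot all_order.
From mathcomp Require Import zify.

(** Call a graph arrowed by [n] when every 2-coloring of the complete graph on
    [n] ordered vertices has a monochromatic copy of it.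

    Lower bound: take colorings on [ramsey G - 1] and [ramsey H - 1] vertices
    with no monochromatic copy of [G] and of [H] respectively, and put the first
    one, one extra vertex, and the second one side by side; the colors of the
    other edges are arbitrary. In a monochromatic copy of [gsum G H], cut between
    the part [G] and the part [H]: either the part [G] lies strictly before the
    extra vertex, or the part [H] lies strictly after it, and both are excluded.

    Upper bound: divide the vertices into a first block of length [ramsey G], a
    middle block of length [ramsey (gsum H G)] and a last block of length
    [ramsey H]. The first block has a copy of [G] of some color [b], the last one
    a copy of [H] of some color [d], and the middle one a copy of [gsum H G] of
    some color [e]. If [d] is [b], the outer copies form a copy of [gsum G H]. If
    [e] is [b], the first copy of [G] is followed by the [H] of the middle copy;
    if [e] is [d], the [G] of the middle copy is followed by the last copy of
    [H]. With two colors, one of these cases must occur.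

    Both arguments move copies between intervals, so they are carried out with
    colorings of pairs of natural numbers and copies inside an interval
    ([mono_in]); [mono_in_gsum] cuts and glues copies of sums, and [arrowsP] and
    [not_arrowsP] relate this to [arrows]. *)

Set Implicit Arguments.
Unset Strict Implicit.
Unset Printing Implicit Defensive.
Import Order.TTheory.

(** * Monochromatic copies in intervals of natural numbers *)

(** Here [chi i j] is the color of the edge between [i] and [j] when [i < j];
    the other values of [chi] carry no meaning, so [chi] need not be symmetric. *)
Definition mono_in (G : ograph) (chi : rel nat) (b : bool) (lo hi : nat) : Prop :=
  exists f : G -> nat,
    [/\ forall x, lo <= f x < hi,
        forall x y : G, (x < y)%O -> f x < f y
      & forall x y : G, (x < y)%O -> adj x y -> chi (f x) (f y) = b].

Lemma mono_in_widen (G : ograph) chi b lo hi lo' hi' :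
  lo' <= lo -> hi <= hi' -> mono_in G chi b lo hi -> mono_in G chi b lo' hi'.
Proof.
move=> lelo lehi [f [f_in f_lt f_col]]; exists f; split=> // x.
by have := f_in x; lia.
Qed.

Lemma eq_mono_in (G : ograph) chi chi' b lo hi :
    (forall i j, lo <= i -> i < j -> j < hi -> chi i j = chi' i j) ->
  mono_in G chi b lo hi -> mono_in G chi' b lo hi.
Proof.
move=> eq_chi [f [f_in f_lt f_col]]; exists f; split=> // x y lt_xy xy.
have /andP[lox _] := f_in x; have /andP[_ hiy] := f_in y.
by rewrite -eq_chi ?f_col ?f_lt.
Qed.

Lemma mono_in_shift (G : ograph) chi b k lo hi :
  mono_in G (fun i j => chi (k + i) (k + j)) b lo hi <->
  mono_in G chi b (k + lo) (k + hi).
Proof.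
split=> -[f [f_in f_lt f_col]].
  exists (fun x => k + f x); split=> [x|x y /f_lt|x y] //; last exact: f_col.
    by have := f_in x; lia.
  by rewrite ltn_add2l.
exists (fun x => f x - k); split=> [x|x y lt_xy|x y lt_xy xy].
- by have := f_in x; lia.
- by have := f_lt _ _ lt_xy; have := f_in x; lia.
- have fK z : k + (f z - k) = f z by have := f_in z; lia.
  by rewrite !fK f_col.
Qed.

Lemma gsum_ltE (G H : ograph) (u v : gsum G H) :
  (u < v)%O = match u, v with
              | inl x, inl y => (x < y)%O
              | inl _, inr _ => true
              | inr _, inl _ => false
              | inr x, inr y => (x < y)%O
              end.
Proof. by case: u v => x [] y; rewrite ?lt_neqAle. Qed.

(** A sum has no edges between its two parts, so cutting and gluing copies puts
    no condition on the colors across the cut. *)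
Lemma mono_in_gsum (G H : ograph) chi b lo hi : lo <= hi ->
  mono_in (gsum G H) chi b lo hi <->
  exists2 m, lo <= m <= hi & mono_in G chi b lo m /\ mono_in H chi b m hi.
Proof.
move=> lohi; split=> [[f [f_in f_lt f_col]]|].
  (* The cut comes just after the last vertex of the part G; starting the maximum
     at lo gives a valid cut even if G has no vertex. *)
  exists (maxn lo (\max_(x : G) (f (inl x)).+1)).
    rewrite leq_maxl geq_max lohi /=.
    by apply/bigmax_leqP => x _; case/andP: (f_in (inl x)).
  split.
    exists (fun x => f (inl x)); split=> [x|x y lt_xy|x y lt_xy].
    - have /andP[-> _] := f_in (inl x).
      by rewrite leq_max (leq_bigmax (F := fun z => (f (inl z)).+1)) orbT.
    - by apply: f_lt; rewrite gsum_ltE.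
    - by apply: (f_col (inl x) (inl y)); rewrite gsum_ltE.
  exists (fun x => f (inr x)); split=> [y|x y lt_xy|x y lt_xy].
  - have /andP[loy ->] := f_in (inr y); rewrite geq_max loy /= andbT.
    by apply/bigmax_leqP => x _; apply: f_lt; rewrite gsum_ltE.
  - by apply: f_lt; rewrite gsum_ltE.
  - by apply: (f_col (inr x) (inr y)); rewrite gsum_ltE.
case=> m m_in [[f [f_in f_lt f_col]] [g [g_in g_lt g_col]]].
exists (fun u : gsum G H => match u with inl x => f x | inr y => g y end).
split=> [[x|y]|[x|x] [y|y]|[x|x] [y|y]] //; rewrite ?gsum_ltE //.
- by have := f_in x; lia.
- by have := g_in y; lia.
- exact: f_lt.
- by have := f_in x; have := g_in y; lia.
- exact: g_lt.
- exact: f_col.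
- exact: g_col.
Qed.

(** * Colorings of complete graphs as colorings of pairs of numbers *)

(** As [c] sees only unordered pairs, the two colorings are compared on pairs
    listed in increasing order. *)
Definition colors_as (N : nat) (c : coloring (complete N)) (chi : rel nat) : Prop :=
  forall i j : 'I_N, i < j -> c [set i; j] = chi i j.

Lemma coloring_rel (N : nat) (c : coloring (complete N)) :
  exists chi, colors_as c chi.
Proof.
exists (fun m n =>
  [exists i : 'I_N, exists j : 'I_N, [&& i == m :> nat, j == n :> nat & c [set i; j]]]).
move=> i j _; apply/idP/existsP => [cij|[i' /existsP[j']]].
  by exists i; apply/existsP; exists j; rewrite !eqxx.
by case/and3P=> /eqP/val_inj-> /eqP/val_inj->.
Qed.

Lemma rel_coloring (N : nat) (chi : rel nat) :
  exists c : coloring (complete N), colors_as c chi.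
Proof.
exists [ffun S : {set 'I_N} => [exists i in S, exists j in S, (i < j) && chi i j]].
move=> i j lt_ij; rewrite ffunE; apply/existsP/idP => [[i']|chi_ij].
  case/andP; rewrite !inE => i'P /existsP[j' /andP[]]; rewrite !inE.
  case/orP: i'P => /eqP-> /orP[] /eqP-> /andP[] //; try by rewrite ltnn.
  by rewrite ltnNge ltnW.
exists i; rewrite !inE eqxx /=; apply/existsP; exists j.
by rewrite !inE eqxx orbT lt_ij.
Qed.

(** An injection that preserves the order weakly preserves it strictly, and any
    injection into a complete graph maps edges to edges; only the strict order
    and the colors are left to compare. *)
Lemma mono_copyP (G : ograph) (N : nat) (c : coloring (complete N)) chi b :
  colors_as c chi ->
  [exists f : {ffun G -> complete N}, is_mono_copy c b f] <->
  mono_in G chi b 0 N.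
Proof.
move=> c_chi; split=> [/existsP[f]|[f [f_in f_lt f_col]]].
  case/andP=> /and3P[/injectiveP f_inj f_le _] f_col.
  have f_lt (x y : G) : (x < y)%O -> (f x : 'I_N) < (f y : 'I_N).
    rewrite lt_neqAle => /andP[ne_xy le_xy].
    have := forallP (forallP f_le x) y; rewrite le_xy /= => le_fxy.
    rewrite ltn_neqAle; apply/andP; split; last exact: le_fxy.
    by apply: contra ne_xy => /eqP/val_inj/f_inj->.
  exists (fun x => val (f x : 'I_N)); split=> [x|//|x y lt_xy xy].
    exact: ltn_ord.
  have := forallP (forallP f_col x) y; rewrite xy /= => /eqP <-.
  by rewrite -c_chi ?f_lt.
have f_ord x : f x < N by have := f_in x; lia.
pose g := [ffun x : G => Ordinal (f_ord x) : complete N].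
have gE x : g x = Ordinal (f_ord x) by rewrite ffunE.
have g_inj : injective g.
  move=> x y; rewrite !gE => /(congr1 val) /= fxy.
  by case: (ltgtP x y) => // /f_lt; rewrite fxy ltnn.
have adj_neq (x y : G) : adj x y -> x != y.
  by apply: contraTneq => ->; rewrite adj_irr.
apply/existsP; exists g; apply/andP; split; first (apply/and3P; split).
- exact/injectiveP.
- apply/forallP=> x; apply/forallP=> y; apply/implyP.
  rewrite le_eqVlt => /orP[/eqP->//|/f_lt lt_fxy].
  by rewrite !gE; apply: ltnW.
- apply/forallP=> x; apply/forallP=> y; apply/implyP=> /adj_neq.
  by apply: contraNneq => /g_inj ->.
have g_col x y : (x < y)%O -> adj x y -> c [set g x; g y] == b.
  by move=> lt_xy xy; rewrite !gE c_chi /= ?f_col // f_lt.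
apply/forallP=> x; apply/forallP=> y; apply/implyP=> xy.
have := adj_neq _ _ xy; rewrite neq_lt => /orP[] lt_xy; first exact: g_col.
by rewrite setUC g_col // adj_sym.
Qed.

Lemma arrowsP (G : ograph) (N : nat) :
  arrows G N <-> forall chi, exists b, mono_in G chi b 0 N.
Proof.
split=> [/forallP G_N chi|G_N].
  have [c c_chi] := rel_coloring N chi.
  have /existsP[b G_b] := G_N c; exists b.
  exact/(mono_copyP G b c_chi).
apply/forallP=> c; have [chi c_chi] := coloring_rel c.
have [b G_b] := G_N chi; apply/existsP; exists b.
exact/(mono_copyP G b c_chi).
Qed.

Lemma not_arrowsP (G : ograph) (N : nat) :
  ~~ arrows G N -> exists chi, forall b, ~ mono_in G chi b 0 N.
Proof.
rewrite negb_forall => /existsP[c no_copy]; have [chi c_chi] := coloring_rel c.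
exists chi => b G_b; case/negP: no_copy; apply/existsP; exists b.
exact/(mono_copyP G b c_chi).
Qed.

Lemma arrows_shift (G : ograph) (N : nat) chi k :
  arrows G N -> exists b, mono_in G chi b k (k + N).
Proof.
move/arrowsP/(_ (fun i j => chi (k + i) (k + j))) => [b G_b].
by exists b; rewrite -[k in mono_in _ _ _ k _]addn0; apply/mono_in_shift.
Qed.

(** * The Ramsey number of a sum *)

Lemma arrows_ramsey (G : ograph) : arrows G (ramsey G).
Proof. by rewrite /ramsey; case: ex_minnP. Qed.

Lemma ramsey_le (G : ograph) (N : nat) : arrows G N -> ramsey G <= N.
Proof. by rewrite /ramsey; case: ex_minnP => m _; apply. Qed.

Lemma ramsey_gt0 (G : ograph) : 0 < #|G| -> 0 < ramsey G.
Proof.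
case/card_gt0P=> x _; rewrite lt0n; apply: contraTneq (arrows_ramsey G) => ->.
apply/negP=> /arrowsP/(_ (fun _ _ => true))[b [f [f_in _ _]]].
by have := f_in x.
Qed.

(** The blocks of the lower-bound coloring are the numbers below [a] and those
    from [a.+1] on; an edge with just one end in the first block, or with an end at
    the extra vertex [a], gets an irrelevant color. *)
Lemma ramsey_gsum_ge (G H : ograph) : 0 < #|G| -> 0 < #|H| ->
  ramsey G + ramsey H <= ramsey (gsum G H).
Proof.
move=> /ramsey_gt0 RG_gt0 /ramsey_gt0 RH_gt0; rewrite leqNgt; apply/negP=> ltR.
set a := (ramsey G).-1; set b := (ramsey H).-1.
have [chiG noG] : exists chi, forall e, ~ mono_in G chi e 0 a.
  by apply/not_arrowsP/negP=> /ramsey_le; lia.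
have [chiH noH] : exists chi, forall e, ~ mono_in H chi e 0 b.
  by apply/not_arrowsP/negP=> /ramsey_le; lia.
pose chi i j := if j < a then chiG i j else chiH (i - a.+1) (j - a.+1).
have /arrowsP/(_ chi)[e] := arrows_ramsey (gsum G H).
case/mono_in_gsum=> // m m_in [G_m H_m].
have [le_ma|lt_am] := leqP m a.
  case: (noG e); apply: eq_mono_in (mono_in_widen (leqnn 0) le_ma G_m) => i j _ _.
  by rewrite /chi => ->.
case: (noH e); apply: (@eq_mono_in _ (fun i j => chi (a.+1 + i) (a.+1 + j))).
  by move=> i j _ _ _; rewrite /chi !addKn ifF //; lia.
by apply/mono_in_shift; apply: mono_in_widen H_m; lia.
Qed.

(** The blocks end at [m1], [m3] and [N]; the copy of [gsum H G] in the middle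
    block is cut at [m2]. *)
Lemma ramsey_gsum_le (G H : ograph) :
  ramsey (gsum G H) <= ramsey G + ramsey H + ramsey (gsum H G).
Proof.
set N := ramsey G + ramsey H + _; apply/ramsey_le/arrowsP=> chi.
set m1 := ramsey G; set m3 := m1 + ramsey (gsum H G).
have [b G1] : exists b, mono_in G chi b 0 m1.
  exact: arrows_shift chi 0 (arrows_ramsey G).
have [e] := arrows_shift chi m1 (arrows_ramsey (gsum H G)).
case/mono_in_gsum=> [|m2 m2_in [H2 G2]]; first exact: leq_addr.
have [d] := arrows_shift chi m3 (arrows_ramsey H).
have -> : m3 + ramsey H = N by rewrite /m3 /m1 /N addnAC.
move=> H3.
have glue c m : m <= N -> mono_in G chi c 0 m -> mono_in H chi c m N ->
    exists b', mono_in (gsum G H) chi b' 0 N.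
  by move=> le_mN Gc Hc; exists c; apply/mono_in_gsum=> //; exists m.
have [eq_db|ne_db] := eqVneq d b.
  by apply: (glue b m1); rewrite // -?eq_db; [lia | apply: mono_in_widen H3; lia].
have [eq_eb|ne_eb] := eqVneq e b.
  apply: (glue b m1) => //; first by lia.
  by rewrite -eq_eb; apply: mono_in_widen H2; lia.
have eq_ed : e = d by case: (b) (d) (e) ne_db ne_eb => [] [] [].
apply: (glue d m3) => //; first by lia.
by rewrite -eq_ed; apply: mono_in_widen G2; lia.
Qed.

Theorem lemma4 (G H : ograph) (G_gt0 : 0 < #|G|) (H_gt0 : 0 < #|H|) :
  ramsey G + ramsey H <= ramsey (gsum G H) <=
    ramsey G + ramsey H + ramsey (gsum H G).
Proof. by rewrite ramsey_gsum_ge // ramsey_gsum_le. Qed.
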